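(* Let $\mathcal P$ be a finite non-empty set, $O\in\mathcal P$, $D$ a finite group, and $\mathcal D=D\times\mathcal P^2$ the corresponding connected groupoid on the base $\mathcal P$, with $D$ identified with the vertex group $\mathcal D(O)$; fix $\tau_P\in\mathcal D(O,P)$ for each $P\in\mathcal P$. Let $\mathcal H$, $\mathcal V$ be wide subgroupoids of $\mathcal D$, associated (as described in the context) to data $(\sim_H,(H_P)_{P\in\mathcal P},(\overline{d_{PQ}})_{P\sim_H Q})$ and $(\sim_V,(V_P)_{P\in\mathcal P},(\overline{e_{PQ}})_{P\sim_V Q})$, respectively. The following are equivalent: (1) $\mathcal D=\mathcal V\mathcal H$ is an exact factorization. (2) The following conditions hold: (a) for all $P,Q\in\mathcal P$, $$D=\coprod_{R\in\mathcal P:\ P\sim_V R,\ R\sim_H Q}V_P\,e_{PR}\,d_{RQ}\,H_Q$$ (i.e. $D$ is the union of these subsets, and the subsets for distinct $R$ are disjoint); (b) for all $P\in\mathcal P$, $V_P\cap H_P=\{e\}$.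
   Context: Convention: in a groupoid, $fg$ means ''first $f$, then $g$''; $\mathcal D(P,Q)$ is the set of arrows from $P$ to $Q$ and $\mathcal D(P)=\mathcal D(P,P)$. $\mathcal P^2$ is the coarse groupoid on $\mathcal P$ (exactly one arrow $(P,Q)$ from each $P$ to each $Q$). A wide subgroupoid of $\mathcal D$ is a subgroupoid with the same set of objects. An exact factorization $\mathcal D=\mathcal V\mathcal H$ is a pair of wide subgroupoids $\mathcal V,\mathcal H$ such that every arrow $\alpha$ of $\mathcal D$ can be written uniquely as $\alpha=fy$ with $f\in\mathcal V$, $y\in\mathcal H$ composable. Data associated to a wide subgroupoid $\mathcal H$ of $\mathcal D$ (with respect to the fixed $\tau_P$): $P\sim_H Q$ iff $\mathcal H(P,Q)\neq\emptyset$ (an equivalence relation); $H_P=\tau_P\mathcal H(P)\tau_P^{-1}$, a subgroup of $D=\mathcal D(O)$; and, for $P\sim_H Q$, $\overline{d_{PQ}}\in H_P\backslash D/H_Q$ is the double coset of $d_{PQ}:=\tau_P h_{PQ}\tau_Q^{-1}$ for any $h_{PQ}\in\mathcal H(P,Q)$ (independent of the choice of $h_{PQ}$). One has $d_{PQ}H_Q=H_Pd_{PQ}$ and $\mathcal H(P,Q)=\tau_P^{-1}H_Pd_{PQ}\tau_Q$ for $P\sim_H Q$. The data $(\sim_V,(V_P),(\overline{e_{PQ}}))$ is associated to $\mathcal V$ in the same way. In (2)(a), $d_{PQ}$ and $e_{PQ}$ denote representatives of the corresponding double cosets. *)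

(* Defs.v *)
From mathcomp Require Import all_boot all_fingroup.

Set Implicit Arguments.
Unset Strict Implicit.
Unset Printing Implicit Defensive.

Local Open Scope group_scope.

Section Groupoid.

Variables (T : finType) (gT : finGroupType).

(* The groupoid D x T^2, where D is the whole group gT: the arrow (g, (P, Q))
   goes from P to Q. *)
Definition arrow : finType := (gT * (T * T))%type.

Definition elt (f : arrow) : gT := f.1.
Definition src (f : arrow) : T := f.2.1.
Definition tgt (f : arrow) : T := f.2.2.

Definition aid (P : T) : arrow := (1, (P, P)).
(* First f, then g; meaningful only when tgt f = src g. *)
Definition acomp (f g : arrow) : arrow := (elt f * elt g, (src f, tgt g)).
Definition ainv (f : arrow) : arrow := ((elt f)^-1, (tgt f, src f)).

Definition hom (H : {set arrow}) (P Q : T) : {set arrow} :=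
  [set f in H | (src f == P) && (tgt f == Q)].

Definition wide_subgroupoid (H : {set arrow}) : Prop :=
  [/\ forall P : T, aid P \in H,
      forall f g : arrow, f \in H -> g \in H -> tgt f = src g ->
        acomp f g \in H
    & forall f : arrow, f \in H -> ainv f \in H].

Definition exact_factorization (V H : {set arrow}) : Prop :=
  [/\ wide_subgroupoid V, wide_subgroupoid H
    & forall a : arrow, exists! fy : arrow * arrow,
        [/\ fy.1 \in V, fy.2 \in H, tgt fy.1 = src fy.2
          & a = acomp fy.1 fy.2]].

Definition gconn (H : {set arrow}) (P Q : T) : bool := hom H P Q != set0.

Section Data.

(* A family of arrows tau P : O -> P. The arrows tau_P h tau_Q^-1 below all lie
   in the vertex group at O, which is identified with gT through elt. *)
Variables (tau : T -> arrow) (H : {set arrow}).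

Definition transport (P Q : T) (h : arrow) : gT :=
  elt (acomp (acomp (tau P) h) (ainv (tau Q))).

Definition vgroup (P : T) : {set gT} := [set transport P P h | h in hom H P P].

(* The double coset of tau_P h tau_Q^-1 for an arbitrary h in H(P, Q); see
   dcosetE for the independence of h. *)
Definition dcoset (P Q : T) : {set gT} :=
  if [pick h in hom H P Q] is Some h
  then vgroup P :* transport P Q h * vgroup Q
  else set0.

Lemma dcosetE (P Q : T) (h : arrow) :
  wide_subgroupoid H -> h \in hom H P Q ->
  dcoset P Q = vgroup P :* transport P Q h * vgroup Q.
Proof.
move=> [_ Hc Hi].
have sub (k l : arrow) : k \in hom H P Q -> l \in hom H P Q ->
    vgroup P :* transport P Q k \subset vgroup P :* transport P Q l.
  rewrite !inE => /and3P[kH /eqP sk /eqP tk] /and3P[lH /eqP sl /eqP tl].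
  apply/subsetP=> _ /rcosetP[_ /imsetP[m + ->] ->].
  rewrite inE => /and3P[mH /eqP sm /eqP tm].
  apply/rcosetP.
  exists (transport P P (acomp m (acomp k (ainv l)))).
    apply: imset_f; rewrite inE; apply/and3P; split; last 2 first.
    - by apply/eqP.
    - by apply/eqP.
    apply: (Hc) => //; last by rewrite tm -sk.
    by apply: (Hc) => //; [apply: Hi | rewrite tk -tl].
  by rewrite /transport /= /elt /= !mulgA !mulgKV.
move=> hH; rewrite /dcoset; case: pickP => [k kH | /(_ h)]; last by rewrite hH.
by congr (_ * _); apply/eqP; rewrite eqEsubset !sub.
Qed.

End Data.

End Groupoid.

(* Main.v *)
(* Conjugating by tau turns V(P, R) and H(R, Q) into the cosets V_P e_PR and
   d_RQ H_Q of D.  Exactness then says that every x in D is uniquely v h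
   with v in V_P e_PR and h in d_RQ H_Q for some R.  Disjointness of the
   products makes R unique; for fixed R, two factorizations v h = v' h' give
   v^-1 v' = h h'^-1 in V_R and in H_R, so uniqueness is the triviality of
   these intersections. *)

Require Import Defs.
From mathcomp Require Import all_boot all_fingroup.

Local Open Scope group_scope.

Section TransportedHom.

Set Implicit Arguments.
Unset Strict Implicit.

Context {T : finType} {gT : finGroupType}.
Implicit Types (tau : T -> arrow T gT) (H V : {set arrow T gT}).

(** The set $\tau_P\mathcal H(P,Q)\tau_Q^{-1}$ inside $D$. Its diagonal case [thom tau H P P] is
    [vgroup tau H P] by definition, so the lemmas below apply to vertex groups as they stand. *)
Definition thom tau H (P Q : T) : {set gT} :=
  [set transport tau P Q h | h in hom H P Q].

(** The arrow $\tau_P^{-1}x\tau_Q$, which inverts [transport] once the endpoints are fixed. *)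
Definition untransport tau (P Q : T) (x : gT) : arrow T gT :=
  ((elt (tau P))^-1 * x * elt (tau Q), (P, Q)).

Lemma transportK tau (a : arrow T gT) :
  untransport tau (src a) (tgt a) (transport tau (src a) (tgt a) a) = a.
Proof.
case: a => g [P Q].
by rewrite /untransport /transport /elt /= !mulgA mulVg mul1g mulgKV.
Qed.

Lemma mem_thom tau H P Q x :
  (x \in thom tau H P Q) = (untransport tau P Q x \in H).
Proof.
apply/imsetP/idP => [[h + ->]|xH].
  by rewrite inE => /and3P[hH /eqP <- /eqP <-]; rewrite transportK.
exists (untransport tau P Q x); first by rewrite inE xH /= !eqxx.
by rewrite /transport /untransport /elt /= !mulgA mulgV mul1g mulgK.
Qed.

Lemma acomp_untransport tau P Q R x y :
  acomp (untransport tau P Q x) (untransport tau Q R y)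
  = untransport tau P R (x * y).
Proof. by rewrite /acomp /untransport /elt /= !mulgA mulgK. Qed.

Lemma untransport_inj tau P Q R S x y :
  untransport tau P Q x = untransport tau R S y -> [/\ P = R, Q = S & x = y].
Proof.
case=> eqx eP eQ; split=> //; move: eqx; rewrite eP eQ.
by move=> /mulIg/mulgI.
Qed.

Lemma gconn_thom tau H P Q x : x \in thom tau H P Q -> gconn H P Q.
Proof. by case/imsetP=> h hH _; apply/set0Pn; exists h. Qed.

Section Subgroupoid.

Context {tau : T -> arrow T gT} {H : {set arrow T gT}}.
Hypothesis hH : wide_subgroupoid H.

Lemma thom1 P : 1 \in thom tau H P P.
Proof.
by rewrite mem_thom /untransport mulg1 mulVg; case: hH => H1 _ _; apply: H1.
Qed.

Lemma thomM P Q R x y :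
  x \in thom tau H P Q -> y \in thom tau H Q R -> x * y \in thom tau H P R.
Proof.
rewrite !mem_thom -(acomp_untransport tau P Q R).
by case: hH => _ HM _ *; apply: HM.
Qed.

Lemma thomV P Q x : x \in thom tau H P Q -> x^-1 \in thom tau H Q P.
Proof.
rewrite !mem_thom; case: hH => _ _ HV /HV.
by rewrite /ainv /untransport /elt /= !invMg invgK mulgA.
Qed.

(** Two arrows from $P$ to $Q$ in the subgroupoid differ by a loop at $P$: $y=(yx^{-1})x$. *)
Lemma vgroup_rcoset P Q x :
  x \in thom tau H P Q -> vgroup tau H P :* x = thom tau H P Q.
Proof.
move=> xH; apply/setP=> y; rewrite mem_rcoset; apply/idP/idP => yH.
  by rewrite -(mulgKV x y); apply: thomM yH xH.
exact: thomM yH (thomV xH).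
Qed.

Lemma vgroup_lcoset P Q x :
  x \in thom tau H P Q -> x *: vgroup tau H Q = thom tau H P Q.
Proof.
move=> xH; apply/setP=> y; rewrite mem_lcoset; apply/idP/idP => yH.
  by rewrite -(mulKVg x y); apply: thomM xH yH.
exact: thomM (thomV xH) yH.
Qed.

(** The one-sided coset $H_Px$ already fills the transported hom-set, and right multiplication by
    $H_Q$ does not leave it. Hence any representative of the double coset comes from an arrow of
    [H]. *)
Lemma dcoset_thom P Q : gconn H P Q -> dcoset tau H P Q = thom tau H P Q.
Proof.
case/set0Pn=> h hPQ; have tH : transport tau P Q h \in thom tau H P Q.
  exact: imset_f.
rewrite (dcosetE _ hH hPQ) (vgroup_rcoset tH) //.
apply/setP=> y; apply/mulsgP/idP => [[u v uH vH ->]|yH].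
  exact: thomM uH vH.
by exists y 1; rewrite ?mulg1 //; apply: thom1.
Qed.

End Subgroupoid.

Lemma mul_dcoset_thom tau H V (e d : gT) P Q R :
  wide_subgroupoid H -> wide_subgroupoid V ->
  e \in thom tau V P R -> d \in thom tau H R Q ->
  vgroup tau V P :* e :* d * vgroup tau H Q
  = thom tau V P R * thom tau H R Q.
Proof.
move=> hH hV eV dH.
by rewrite (vgroup_rcoset hV eV) -mulgA (vgroup_lcoset hH dH).
Qed.

(** For fixed endpoints, factoring an arrow amounts to factoring an element of $D$ through a middle
    object. That object is part of the factorization, so uniqueness must also give [R = R']. *)
Lemma exact_factorization_thom tau H V :
  wide_subgroupoid H -> wide_subgroupoid V ->
  exact_factorization V H <->
  (forall P Q x, exists R, x \in thom tau V P R * thom tau H R Q) /\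
  (forall P Q R R' v v' h h',
     v \in thom tau V P R -> h \in thom tau H R Q ->
     v' \in thom tau V P R' -> h' \in thom tau H R' Q ->
     v * h = v' * h' -> [/\ R = R', v = v' & h = h']).
Proof.
move=> hH hV; split=> [[_ _ exVH] | [ex uniq]].
  split=> [P Q x | P Q R R' v v' h h' vV hhH v'V h'H eq_vh].
    have [[f y] [[/= fV yH tf eq_x] _]] := exVH (untransport tau P Q x).
    move: eq_x fV yH.
    (* With the common middle object [src y], the composite is the untransported product, and
       injectivity identifies its endpoints and its element. *)
    rewrite -(transportK tau f) -(transportK tau y) tf acomp_untransport.
    case/untransport_inj=> -> -> ->; rewrite -!mem_thom => fV yH.
    by exists (src y); apply: mem_mulg.
  have [fy [_ uniq]] := exVH (untransport tau P Q (v * h)).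
  have Ev : fy = (untransport tau P R v, untransport tau R Q h).
    by apply: uniq; rewrite /= -!mem_thom acomp_untransport.
  have Ev' : fy = (untransport tau P R' v', untransport tau R' Q h').
    by apply: uniq; rewrite /= -!mem_thom acomp_untransport eq_vh.
  move: Ev'; rewrite Ev => /pair_equal_spec[].
  by case/untransport_inj=> _ -> -> /untransport_inj[_ _ ->].
split=> // a; rewrite -(transportK tau a).
move: (src a) (tgt a) (transport _ _ _ a) => P Q x.
have [R /mulsgP[v h vV hhH ->]] := ex P Q x.
exists (untransport tau P R v, untransport tau R Q h).
split=> [|[f y] [/= fV yH tf]].
  by rewrite /= -!mem_thom acomp_untransport.
move: fV yH; rewrite -(transportK tau f) -(transportK tau y) tf.
rewrite -!mem_thom acomp_untransport => fV yH /untransport_inj[eP eQ eq_vh].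
move: fV yH eq_vh; rewrite -eP -eQ => fV yH eq_vh.
by have [-> -> ->] := uniq _ _ _ _ _ _ _ _ vV hhH fV yH eq_vh.
Qed.

End TransportedHom.

Theorem theorem2p15 (T : finType) (O : T) (gT : finGroupType)
  (tau : T -> arrow T gT)
  (htau : forall P : T, tau P \in hom [set: arrow T gT] O P)
  (H V : {set arrow T gT})
  (hH : wide_subgroupoid H) (hV : wide_subgroupoid V)
  (d e : T -> T -> gT)
  (hd : forall P Q : T, gconn H P Q -> d P Q \in dcoset tau H P Q)
  (he : forall P Q : T, gconn V P Q -> e P Q \in dcoset tau V P Q) :
  exact_factorization V H <->
  ((forall P Q : T,
      [set: gT] =
        \bigcup_(R | gconn V P R && gconn H R Q)
          (vgroup tau V P :* e P R :* d R Q * vgroup tau H Q)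
      /\ (forall R R' : T,
            gconn V P R && gconn H R Q -> gconn V P R' && gconn H R' Q ->
            R != R' ->
            [disjoint vgroup tau V P :* e P R :* d R Q * vgroup tau H Q
             & vgroup tau V P :* e P R' :* d R' Q * vgroup tau H Q]))
   /\ (forall P : T, vgroup tau V P :&: vgroup tau H P = [set 1])).
Proof.
have dE P Q : gconn H P Q -> d P Q \in thom tau H P Q.
  by move=> cH; rewrite -dcoset_thom ?hd.
have eE P Q : gconn V P Q -> e P Q \in thom tau V P Q.
  by move=> cV; rewrite -dcoset_thom ?he.
have prodE P Q R : gconn V P R && gconn H R Q ->
    vgroup tau V P :* e P R :* d R Q * vgroup tau H Q
    = thom tau V P R * thom tau H R Q.
  by case/andP=> /eE eV /dE dH; apply: mul_dcoset_thom.
apply: (iff_trans (exact_factorization_thom tau hH hV)).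
split=> [[ex uniq] | [part triv]].
  split=> [P Q | P].
    split=> [|R R' cR cR' neqR].
      apply/setP=> x; rewrite inE; apply/esym/bigcupP.
      have [R xR] := ex P Q x; have cR : gconn V P R && gconn H R Q.
        by case/mulsgP: xR => v h /gconn_thom-> /gconn_thom->.
      by exists R; rewrite ?prodE.
    rewrite !prodE //; apply/pred0P=> x /=; apply/negP.
    case/andP=> /mulsgP[v h vV hhH ->] /mulsgP[v' h' v'V h'H eq_vh].
    have [eqR _ _] := uniq _ _ _ _ _ _ _ _ vV hhH v'V h'H eq_vh.
    by rewrite eqR eqxx in neqR.
  apply/setP=> x; rewrite !inE; apply/andP/eqP => [[xV xH]|->]; last first.
    by split; apply: thom1.
  have xH' := thomV hH xH.
  (* An element of both vertex groups gives a second factorization of the identity through $P$,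
     besides the trivial one. *)
  have eq1 : x * x^-1 = 1 * 1 by rewrite mulgV mulg1.
  by have [_ -> _] :=
    uniq _ _ _ _ _ _ _ _ xV xH' (thom1 hV P) (thom1 hH P) eq1.
split=> [P Q x | P Q R R' v v' h h' vV hhH v'V h'H eq_vh].
  have [cover _] := part P Q; have : x \in [set: gT] by rewrite inE.
  by rewrite cover => /bigcupP[R cR]; rewrite prodE // => xR; exists R.
have [_ disj] := part P Q.
have cR : gconn V P R && gconn H R Q.
  by rewrite (gconn_thom vV) (gconn_thom hhH).
have cR' : gconn V P R' && gconn H R' Q.
  by rewrite (gconn_thom v'V) (gconn_thom h'H).
have eqR : R = R'.
  (* Otherwise the common product [v * h] would lie in the pieces of two distinct middle objects. *)
  apply/eqP/negPn/negP=> /(disj _ _ cR cR'); rewrite !prodE // => /pred0P.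
  by move/(_ (v * h)); rewrite /= mem_mulg // eq_vh mem_mulg.
move: v'V h'H; rewrite -eqR => v'V h'H.
(* With the middle objects equal, both sides are loops at [R], one from [V] and one from [H]. *)
have eq_w : v^-1 * v' = h * h'^-1.
  by rewrite -(mulgK h' v') -eq_vh !mulgA mulVg mul1g.
have : v^-1 * v' \in vgroup tau V R :&: vgroup tau H R.
  rewrite inE; apply/andP; split.
    exact: (thomM hV (thomV hV vV) v'V).
  rewrite eq_w; exact: (thomM hH hhH (thomV hH h'H)).
rewrite triv inE => /eqP w1; split=> //.
  by apply/esym/(mulgI v^-1); rewrite w1 mulVg.
by apply: (mulIg h'^-1); rewrite -eq_w w1 mulgV.
Qed.
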